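(* Let $\mathcal{A},\mathcal{B}\in\mathbb{R}^{n\times n\times p}$ be Hermitian tensors. Then the following inequality holds: $$\sum_{i=1}^{n}\lambda_i(\mathcal{A})\,\lambda_{n-i+1}(\mathcal{B})\;\le\;\operatorname{tr}(\mathcal{A}*\mathcal{B})\;\le\;\sum_{i=1}^{n}\lambda_i(\mathcal{A})\,\lambda_i(\mathcal{B}),$$ where $\lambda_i(\mathcal{A})$ and $\lambda_i(\mathcal{B})$ denote the eigenvalues (T-eigenvalues) of $\mathcal{A}$ and $\mathcal{B}$, respectively, arranged in non-increasing order, and $*$ represents the T-product for tensors.
   Context: For a third-order tensor $\mathcal{A}$ of size $m\times n\times p$, its frontal slices are $A^{(k)}=\mathcal{A}(:,:,k)$, $k=1,\dots,p$. The block circulant matrix $\operatorname{bcirc}(\mathcal{A})$ is the $mp\times np$ matrix whose $(i,j)$ block ($1\le i,j\le p$) is $A^{(((i-j)\bmod p)+1)}$. $\operatorname{unfold}(\mathcal{A})$ is the $mp\times n$ matrix obtained by stacking $A^{(1)},\dots,A^{(p)}$ vertically, and $\operatorname{fold}$ is its inverse. The T-product of $\mathcal{A}$ (size $m\times n\times p$) and $\mathcal{B}$ (size $n\times s\times p$) is $\mathcal{A}*\mathcal{B}=\operatorname{fold}(\operatorname{bcirc}(\mathcal{A})\operatorname{unfold}(\mathcal{B}))$, of size $m\times s\times p$. The conjugate transpose $\mathcal{A}^*$ is obtained by conjugate-transposing each frontal slice and reversing the order of slices $2,\dots,p$; $\mathcal{A}$ is Hermitian if $\mathcal{A}=\mathcal{A}^*$.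 A number $\lambda$ is a T-eigenvalue of $\mathcal{A}\in\mathbb{R}^{n\times n\times p}$ if $\mathcal{A}*\mathcal{X}=\lambda\mathcal{X}$ for some nonzero $\mathcal{X}$ of size $n\times 1\times p$; the T-eigenvalues of $\mathcal{A}$ are the eigenvalues of $\operatorname{bcirc}(\mathcal{A})$, and they are all real when $\mathcal{A}$ is Hermitian. The trace of a T-product is $\operatorname{tr}(\mathcal{A}*\mathcal{B})=\sum_{k=1}^p\operatorname{tr}(\widehat{\mathcal{A}}^{(k)}\widehat{\mathcal{B}}^{(k)})$, where $\widehat{\mathcal{A}}^{(k)}$ is the $k$-th frontal slice of the (unnormalized) discrete Fourier transform $\widehat{\mathcal{A}}$ of $\mathcal{A}$ along the third mode, and similarly for $\mathcal{B}$.
   Formalization: The sums run over all np T-eigenvalues, with λ_{np-i+1}(B) in place of λ_{n-i+1}(B), since with upper limit n the claim fails for p ≥ 2 (for n=1, p=2 and A=B the identity tensor, the trace is 2 but the right side is 1). *)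

(* Defs.v *)
From HB Require Import structures.
From mathcomp Require Import all_boot all_order all_algebra.
From mathcomp Require Import complex.
From mathcomp Require Import reals trigo.
From mathcomp Require Import ring.

Set Implicit Arguments.
Unset Strict Implicit.
Unset Printing Implicit Defensive.

Import Order.TTheory GRing.Theory Num.Theory.
Local Open Scope ring_scope.
Local Open Scope complex_scope.

(* Frontal slices are indexed from 0, by ['I_p]. Operations that need slice
   indices modulo the third dimension are stated for a third dimension [p.+1],
   where [- k] and [i - j] on ['I_p.+1] are computed modulo [p.+1]. *)
Definition tensor (T : Type) (m n p : nat) := {ffun 'I_p -> 'M[T]_(m, n)}.

Section TProduct.
Variables (F : pzRingType) (p : nat).

Definition bcirc m n (A : tensor F m n p.+1) :
    'M[F]_(\sum_(i < p.+1) m, \sum_(j < p.+1) n) :=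
  \mxblock_(i < p.+1, j < p.+1) A (i - j).

Definition unfold m n (A : tensor F m n p.+1) : 'M[F]_(\sum_(i < p.+1) m, n) :=
  \mxcol_(i < p.+1) A i.

Definition fold m n (M : 'M[F]_(\sum_(i < p.+1) m, n)) : tensor F m n p.+1 :=
  [ffun i => submxcol M i].

Definition tprod m n s (A : tensor F m n p.+1) (B : tensor F n s p.+1) :
    tensor F m s p.+1 :=
  fold (bcirc A *m unfold B).

End TProduct.

Section Complex.
Variables (R : realType) (p : nat).

Definition tcomplex m n (A : tensor R m n p.+1) : tensor R[i] m n p.+1 :=
  [ffun k => map_mx (real_complex R) (A k)].

Definition tctr m n (A : tensor R[i] m n p.+1) : tensor R[i] n m p.+1 :=
  [ffun k => map_mx conjc (A (- k))^T].

Definition thermitian n (A : tensor R[i] n n p.+1) : Prop := A = tctr A.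

Definition teigenvalue n (A : tensor R[i] n n p.+1) (l : R[i]) : Prop :=
  exists2 X : tensor R[i] n 1 p.+1, X != 0 & tprod A X = l *: X.

(* The T-eigenvalues counted with their multiplicity as eigenvalues of [bcirc A],
   [p.+1 * n] in total. The order of [R[i]] is partial: it only compares numbers
   with equal imaginary parts, so the list is known to be non-increasing when
   the T-eigenvalues are real ([teigs_sorted]). *)
Definition teigs n (A : tensor R[i] n n p.+1) : seq R[i] :=
  sort >=%R (sval (closed_field_poly_normal (char_poly (bcirc A)))).

Definition teig n (A : tensor R[i] n n p.+1) (i : nat) : R[i] :=
  nth 0 (teigs A) i.

(* $e^{-2\pi\mathrm{i}/(p+1)}$ *)
Definition dft_root : R[i] :=
  cos (2 * pi / p.+1%:R) -i* sin (2 * pi / p.+1%:R).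

Definition dft m n (A : tensor R[i] m n p.+1) : tensor R[i] m n p.+1 :=
  [ffun k : 'I_p.+1 => \sum_(j < p.+1) dft_root ^+ (j * k) *: A j].

Definition tr_tprod n (A B : tensor R[i] n n p.+1) : R[i] :=
  \sum_(k < p.+1) \tr (dft A k *m dft B k).

End Complex.

Section Facts.
Variables (R : realType) (p : nat).
Local Notation C := R[i].

Lemma eigenvalue_tr (F : fieldType) m (M : 'M[F]_m) a :
  eigenvalue M^T a = eigenvalue M a.
Proof.
rewrite /eigenvalue /eigenspace !kermx_eq0 /row_free -(mxrank_tr (M - _)).
by rewrite linearB /= tr_scalar_mx.
Qed.

Lemma unfoldK m n : cancel (@unfold C p m n) (@fold C p m n).
Proof. by move=> A; apply/ffunP => i; rewrite ffunE mxcolK. Qed.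

Lemma foldK m n : cancel (@fold C p m n) (@unfold C p m n).
Proof. by move=> A; apply/mxcolP => i; rewrite mxcolK ffunE. Qed.

Lemma unfoldZ m n l (A : tensor C m n p.+1) : unfold (l *: A) = l *: unfold A.
Proof.
by apply/matrixP => a b; rewrite !mxE ffunE mxE.
Qed.

Lemma teigsP n (A : tensor C n n p.+1) l : l \in teigs A <-> teigenvalue A l.
Proof.
have -> : l \in teigs A = eigenvalue (bcirc A)^T l.
  rewrite eigenvalue_tr eigenvalue_root_char /teigs mem_sort.
  case: closed_field_poly_normal => r /= ->.
  by rewrite (monicP (char_poly_monic _)) scale1r root_prod_XsubC.
split.
  case/eigenvalueP => v Hv v0; exists (fold v^T).
    apply: contra_neq v0 => H; apply/eqP; rewrite -trmx_eq0 -[v^T]foldK H.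
    by rewrite -(scale0r 0) unfoldZ scale0r.
  rewrite /tprod foldK -[bcirc A]trmxK -trmx_mul Hv linearZ /=.
  by rewrite -[v^T]foldK -unfoldZ unfoldK foldK.
case=> X X0 HX; apply/eigenvalueP; exists (unfold X)^T.
  by rewrite -trmx_mul -[bcirc A *m _]foldK [fold _]HX unfoldZ linearZ.
by apply: contra_neq X0 => /eqP; rewrite trmx_eq0 => /eqP H;
  rewrite -[X]unfoldK H; apply/ffunP => i; rewrite !ffunE submxcol0.
Qed.

Lemma size_teigs n (A : tensor C n n p.+1) : size (teigs A) = (p.+1 * n)%N.
Proof.
rewrite /teigs size_sort; case: closed_field_poly_normal => r /= Hr.
have := congr1 (fun q : {poly C} => size q) Hr.
rewrite (monicP (char_poly_monic _)) scale1r size_char_poly size_prod_XsubC.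
by case=> <-; rewrite sum_nat_const card_ord.
Qed.

Lemma bcirc_tctr m n (A : tensor C m n p.+1) :
  bcirc (tctr A) = map_mx conjc (bcirc A)^T.
Proof.
by apply/matrixP => a b; rewrite !mxE ffunE opprB !mxE.
Qed.

Lemma teigs_real n (A : tensor C n n p.+1) :
  thermitian A -> {in teigs A, forall l, l \is Num.real}.
Proof.
move=> hA l; rewrite /teigs mem_sort.
have -> : (l \in sval (closed_field_poly_normal (char_poly (bcirc A)))) =
          eigenvalue (bcirc A) l.
  rewrite eigenvalue_root_char.
  case: closed_field_poly_normal => r /= ->.
  by rewrite (monicP (char_poly_monic _)) scale1r root_prod_XsubC.
case/eigenvalueP => v Hv v0.
have hB : map_mx conjc (bcirc A)^T = bcirc A by rewrite -bcirc_tctr -hA.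
have Hv' : bcirc A *m map_mx conjc v^T = conjc l *: map_mx conjc v^T.
  by rewrite -{1}hB -map_mxM -trmx_mul Hv linearZ /= map_mxZ.
have := mulmxA v (bcirc A) (map_mx conjc v^T).
rewrite Hv Hv' -scalemxAl -scalemxAr => /matrixP /(_ 0 0); rewrite !mxE.
have n0 : \sum_j v 0 j * (map_mx conjc v^T) j 0 != 0.
  apply: contra v0 => /eqP H; apply/eqP/rowP => j; rewrite mxE.
  have F0 i : true -> 0 <= v 0 i * (map_mx conjc v^T) i 0.
    by move=> _; rewrite !mxE mulcJ_ge0.
  have /eqP := psumr_eq0P F0 H (erefl : true) (i := j).
  by rewrite !mxE mulf_eq0 conjc_eq0 orbb => /eqP.
move/(mulIf n0); case: {Hv Hv'} l => a b [] /eqP.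
by rewrite eq_sym -addr_eq0 -mulr2n mulrn_eq0 /= => /eqP ->; rewrite realE !lecE /= !eqxx /= -realE num_real.
Qed.

Lemma teigs_sorted n (A : tensor C n n p.+1) :
  thermitian A -> sorted >=%R (teigs A).
Proof.
move=> hA; apply: (@sort_sorted_in _ Num.real).
  by move=> x y xr yr; rewrite orbC; apply: real_leVge.
by apply/allP => l ll; apply: (teigs_real hA); rewrite /teigs mem_sort.
Qed.

Lemma tr_tprodE n (A B : tensor C n n p.+1) :
  tr_tprod A B = \sum_(k < p.+1) \tr (dft (tprod A B) k).
Proof.
have root1 : dft_root R p ^+ p.+1 = 1.
  have H m x : (cos x -i* sin x) ^+ m = cos (m%:R * x) -i* sin (m%:R * x) :> C.
    elim: m => [|m IH]; first by rewrite expr0 mul0r cos0 sin0 oppr0.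
    rewrite exprS IH -natr1 mulrDl mul1r cosD sinD.
    by congr (_ +i* _); ring.
  rewrite H mulrCA mulfV ?pnatr_eq0 // mulr1 mulr_natl cos2pi sin2pi.
  by rewrite oppr0.
apply: eq_bigr => k _; congr (\tr _); rewrite !ffunE.
pose w (j : 'I_p.+1) := dft_root R p ^+ (j * k).
have wD i j : w (i + j) = w i * w j.
  by rewrite /w -exprD -mulnDl exprM expr_mod // -exprM.
have -> : \sum_(j < p.+1) dft_root R p ^+ (j * k) *: tprod A B j =
   \sum_j \sum_i w j *: (A (j - i) *m B i).
  apply: eq_bigr => j _; rewrite -scaler_sumr; congr (_ *: _).
  by rewrite /tprod /bcirc /unfold mul_mxblock_mxrow ffunE mxcolK.
rewrite exchange_big mulmx_sumr; apply: eq_bigr => i _ /=.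
rewrite mulmx_suml [RHS](reindex_inj (addIr i)); apply: eq_bigr => j _.
by rewrite addrK wD -/(w j) -/(w i) -scalemxAl -scalemxAr scalerA.
Qed.

End Facts.

(* Main.v *)
(* Block circulant matrices are block-diagonalized by the Fourier transform, so
   [tr(A*B)] is the trace of [bcirc A *m bcirc B]. For Hermitian matrices with
   eigenvalues [a], [b], that trace is [\sum_(i, j) a i * b j * `|W i j| ^+ 2]
   with [W] unitary. The weights form a bistochastic matrix, over which such a
   sum is largest at the identity when [a] and [b] are both non-increasing; the
   lower bound is the upper bound applied to [- b] in reverse order. *)
Require Import Defs.
From mathcomp Require Import all_boot all_order all_algebra.
From mathcomp Require Import complex reals.
From mathcomp Require Import trigo perm spectral sesquilinear ring lra.
Import Order.TTheory GRing.Theory Num.Theory.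
Local Open Scope ring_scope.

(* The potentials [u i] and [a j * b j - u j] are a feasible solution of the
   linear program dual to maximizing the left-hand side over bistochastic [D]. *)
Lemma bistochastic_rearrangement (F : numDomainType) (N : nat) (a b : nat -> F)
    (D : 'I_N -> 'I_N -> F) :
  (forall i j, (i <= j < N)%N -> a j <= a i) ->
  (forall i j, (i <= j < N)%N -> b j <= b i) ->
  (forall i j, 0 <= D i j) ->
  (forall i, \sum_j D i j = 1) -> (forall j, \sum_i D i j = 1) ->
  \sum_(i < N) \sum_(j < N) a i * b j * D i j <= \sum_(i < N) a i * b i.
Proof.
move=> ha hb D0 Dr Dc.
(* The increments of [u] are chosen so that the constraint [dual] is tight at [i = j] and at
   [i = j + 1]. *)
pose u m := \sum_(0 <= k < m) b k * (a k.+1 - a k).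
have uB i j : (i <= j)%N -> u j - u i = \sum_(i <= k < j) b k * (a k.+1 - a k).
  by move=> ij; rewrite /u (@big_cat_nat _ _ _ i)//= [LHS]addrC addKr.
have dual (i j : 'I_N) : a i * b j <= u i + (a j * b j - u j).
  rewrite -subr_ge0.
  (* Telescoping the difference of [a] allows a termwise comparison: the increments of [a] are
     nonpositive, and monotonicity compares [b k] with [b j] for every [k] between [i] and [j]. *)
  have [ij|/ltnW ji] := leqP i j.
  - have -> : u i + (a j * b j - u j) - a i * b j =
        (a j - a i) * b j - (u j - u i) by ring.
    rewrite subr_ge0 uB// -telescope_sumr// mulr_suml !big_nat.
    apply: ler_sum => k /andP[ik kj]; rewrite [leRHS]mulrC.
    have kN := leq_ltn_trans kj (ltn_ord j).
    by rewrite ler_wnM2r ?subr_le0 ?ha ?hb ?leqnSn ?(ltnW kj) /=.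
  - have -> : u i + (a j * b j - u j) - a i * b j =
        (u i - u j) - (a i - a j) * b j by ring.
    rewrite subr_ge0 uB// -telescope_sumr// mulr_suml !big_nat.
    apply: ler_sum => k /andP[jk ki]; rewrite [leLHS]mulrC.
    have kN := leq_ltn_trans ki (ltn_ord i).
    by rewrite ler_wnM2r ?subr_le0 ?ha ?hb ?leqnSn ?jk ?(ltnW kN).
apply: (@le_trans _ _ (\sum_(i < N) \sum_(j < N)
   (u i * D i j + (a j * b j - u j) * D i j))).
  apply: ler_sum => i _; apply: ler_sum => j _.
  by rewrite -mulrDl ler_wpM2r.
(* Row sums absorb the weights of [u i], column sums those of [a j * b j - u j]; the potentials then
   cancel. *)
under eq_bigr do rewrite big_split -mulr_sumr Dr mulr1 /=.
rewrite big_split /= exchange_big /=.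
under [X in _ + X]eq_bigr do rewrite -mulr_sumr Dc mulr1.
by rewrite -big_split /=; under eq_bigr do rewrite addrC subrK.
Qed.

Lemma char_poly_conj (F : fieldType) (N : nat) (P M : 'M[F]_N) :
  P \in unitmx -> char_poly (invmx P *m M *m P) = char_poly M.
Proof.
move=> Pu; rewrite /char_poly.
have PV : map_mx polyC (invmx P) *m map_mx polyC P = 1%:M.
  by rewrite -map_mxM mulVmx// map_mx1.
have -> : char_poly_mx (invmx P *m M *m P) =
    map_mx polyC (invmx P) *m char_poly_mx M *m map_mx polyC P.
  rewrite /char_poly_mx mulmxBr mulmxBl !map_mxM scalar_mxC.
  by rewrite -[_%:M *m _ *m _]mulmxA PV mulmx1.
by rewrite !det_mulmx mulrAC -det_mulmx PV det1 mul1r.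
Qed.

Section Spectral.
Local Open Scope sesquilinear_scope.
Variables (C : numClosedFieldType) (N : nat).

(** The spectral theorem leaves the order of the eigenvalues uncontrolled. Both lists consist of the
    roots of one polynomial, so permuting the rows of the spectral basis realizes the order of
    [s]. *)
Lemma unitary_diagonalization (M : 'M[C]_N) (s : seq C) :
  M \is normalmx -> char_poly M = \prod_(x <- s) ('X - x%:P) ->
  exists2 P : 'M[C]_N, P \is unitarymx &
    M = P^t* *m diag_mx (\row_i s`_i) *m P.
Proof.
move=> /orthomx_spectralP; set P := spectralmx M; set d := spectral_diag M.
move=> ME sE; have Pu : P \is unitarymx := spectral_unitarymx M.
have : perm_eq s [tuple d 0 i | i < N].
  apply: prod_XsubC_eq; rewrite -sE ME char_poly_conj ?unitarymx_unit//.
  rewrite char_poly_trig ?diag_mx_is_trig// big_image /=.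
  by apply: eq_bigr => i _; rewrite mxE eqxx.
move=> /tuple_permP[f fE]; exists (row_perm f P).
  apply/unitarymxP/matrixP => i j.
  have /unitarymxP/matrixP/(_ (f i) (f j)) := Pu.
  rewrite !mxE (inj_eq perm_inj) => <-.
  by apply: eq_bigr => k _; rewrite !mxE.
rewrite [LHS]ME invmx_unitary//; apply/matrixP => i j.
rewrite -!mulmxA !mul_diag_mx !mxE (reindex_inj (@perm_inj _ f)) /=.
apply: eq_bigr => k _; rewrite !mxE; congr (_ * (_ * _)).
by rewrite fE -tnth_nth !tnth_mktuple.
Qed.

Lemma unitary_bistochastic (W : 'M[C]_N) : W \is unitarymx ->
  (forall i, \sum_j `|W i j| ^+ 2 = 1) /\ (forall j, \sum_i `|W i j| ^+ 2 = 1).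
Proof.
have row (V : 'M[C]_N) : V \is unitarymx -> forall i, \sum_j `|V i j| ^+ 2 = 1.
  move=> /unitarymxP/matrixP + i => /(_ i i); rewrite !mxE eqxx mulr1n => <-.
  by apply: eq_bigr => j _; rewrite !mxE normCK.
move=> Wu; split; first exact: row.
move=> j; rewrite -[RHS](row W^T _ j) ?trmx_unitary//.
by apply: eq_bigr => i _; rewrite mxE.
Qed.

Lemma mxtrace_unitary_diag (P Q : 'M[C]_N) (a b : 'I_N -> C) :
  \tr (P^t* *m diag_mx (\row_i a i) *m P *m
       (Q^t* *m diag_mx (\row_i b i) *m Q)) =
  \sum_i \sum_j a i * b j * `|(P *m Q^t*) i j| ^+ 2.
Proof.
set W := P *m Q^t*.
have WE : W^t* = Q *m P^t* by rewrite trmx_mul map_mxM trmxCK.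
(* Cyclicity of the trace moves [P^t*] to the end, leaving the two diagonal matrices separated by
   [W] and [W^t*]. *)
rewrite -!mulmxA mxtrace_mulC -!mulmxA -WE [P *m _]mulmxA -/W !mul_diag_mx.
apply: eq_bigr => i _; rewrite !mxE big_distrr; apply: eq_bigr => j _ /=.
by rewrite !mxE normCK; ring.
Qed.

Lemma normal_trace_bounds (M1 M2 : 'M[C]_N) (s t : seq C) :
  M1 \is normalmx -> M2 \is normalmx ->
  char_poly M1 = \prod_(x <- s) ('X - x%:P) ->
  char_poly M2 = \prod_(x <- t) ('X - x%:P) ->
  sorted >=%R s -> sorted >=%R t ->
  \sum_(i < N) s`_i * t`_(rev_ord i) <= \tr (M1 *m M2)
    <= \sum_(i < N) s`_i * t`_i.
Proof.
move=> M1n M2n sE tE s_sorted t_sorted.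
have size_roots (M : 'M[C]_N) r :
    char_poly M = \prod_(x <- r) ('X - x%:P) -> size r = N.
  move=> /(congr1 (fun q : {poly C} => size q)).
  by rewrite size_char_poly size_prod_XsubC => -[].
have noninc (r : seq C) : sorted >=%R r -> size r = N ->
    forall i j, (i <= j < N)%N -> r`_j <= r`_i.
  move=> r_sorted rN i j /andP[ij jN].
  apply: (sorted_leq_nth ge_trans (@lexx _ C) 0 r_sorted) => //;
    by rewrite inE rN ?(leq_ltn_trans ij jN).
have ha := noninc s s_sorted (size_roots _ _ sE).
have hb := noninc t t_sorted (size_roots _ _ tE).
have [P Pu ->] := unitary_diagonalization _ _ M1n sE.
have [Q Qu ->] := unitary_diagonalization _ _ M2n tE.
rewrite mxtrace_unitary_diag; set W := P *m _.
have [Wr Wc] : (forall i, \sum_j `|W i j| ^+ 2 = 1) /\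
    (forall j, \sum_i `|W i j| ^+ 2 = 1).
  by apply: unitary_bistochastic; rewrite mul_unitarymx ?trmxC_unitary.
apply/andP; split; last first.
  have := bistochastic_rearrangement _ N (nth 0 s) (nth 0 t)
    (fun i j => `|W i j| ^+ 2) ha hb.
  by apply=> // i j; rewrite exprn_ge0.
(* On indices below [N], [N - j.+1] is the value of [rev_ord j]; the columns of the weights are
   reversed along with [t]. *)
have := bistochastic_rearrangement _ N (nth 0 s) (fun j => - t`_(N - j.+1))
  (fun i j => `|W i (rev_ord j)| ^+ 2) ha.
move=> H.
have -> : \sum_(i < N) \sum_(j < N) s`_i * t`_j * `|W i j| ^+ 2 =
    - \sum_(i < N) \sum_(j < N)
        s`_i * - t`_(rev_ord j) * `|W i (rev_ord j)| ^+ 2.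
  rewrite -sumrN; apply: eq_bigr => i _.
  rewrite -sumrN (reindex_inj rev_ord_inj); apply: eq_bigr => j _ /=.
  by rewrite mulrN mulNr opprK.
rewrite lerNr -sumrN.
under [leRHS]eq_bigr do rewrite -mulrN.
apply: H => [i j /andP[ij jN]|i j|i|j].
- by rewrite lerN2 hb// leq_sub2l//= ltn_subrL (leq_ltn_trans _ jN).
- by rewrite exprn_ge0.
- by rewrite -(Wr i) [RHS](reindex_inj rev_ord_inj).
- exact: Wc.
Qed.
End Spectral.

Lemma dft_root_expr (R : realType) (p k : nat) :
  dft_root R p ^+ k = (cos (k%:R * (2 * pi / p.+1%:R)) -i*
                       sin (k%:R * (2 * pi / p.+1%:R)))%C.
Proof.
rewrite /dft_root; set x := 2 * pi / _.
elim: k => [|k IH]; first by rewrite expr0 mul0r cos0 sin0 oppr0.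
rewrite exprS IH -natr1 mulrDl mul1r cosD sinD.
by congr (_ +i* _)%C; ring.
Qed.

(** For [j != 0] this is a geometric sum with ratio [w != 1] and [w ^+ p.+1 = 1]. *)
Lemma sum_dft_root (R : realType) (p : nat) (j : 'I_p.+1) :
  \sum_(k < p.+1) dft_root R p ^+ (j * k) = (j == 0)%:R * p.+1%:R.
Proof.
have [->|j0] := eqVneq j 0.
  rewrite mul1r; under eq_bigr do rewrite mul0n expr0.
  by rewrite sumr_const card_ord.
rewrite mul0r; under eq_bigr do rewrite exprM.
set w := dft_root R p ^+ j.
have w1 : w - 1 != 0.
  rewrite subr_eq0 /w dft_root_expr; apply/eqP => -[cos1 _]; move: cos1.
  (* The half angle [y] lies strictly between 0 and [pi], so [sin y > 0], which rules out
     [cos (2y) = 1]. *)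
  pose y := j%:R * pi / p.+1%:R : R.
  have -> : j%:R * (2 * pi / p.+1%:R) = y *+ 2 :> R by rewrite /y; ring.
  have : 0 < sin y.
    apply: sin_gt0_pi; rewrite /y divr_gt0 ?mulr_gt0 ?pi_gt0 ?ltr0n ?lt0n//=.
    by rewrite ltr_pdivrMr ?ltr0n// mulrC ltr_pM2l ?pi_gt0// ltr_nat.
  move=> /(exprn_gt0 2) s0; rewrite cos_mulr2n => c1.
  by have c2 := cos2Dsin2 y; lra.
apply: (mulfI w1); rewrite -subrX1 mulr0 /w -exprM mulnC exprM.
rewrite dft_root_expr mulrCA mulfV ?pnatr_eq0// mulr1 mulr_natl cos2pi sin2pi.
by rewrite oppr0 expr1n subrr.
Qed.

(** Both sides are [p.+1] times the trace of slice 0 of [tprod A B]: summing over all frequencies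
    isolates that slice, and every diagonal block of [bcirc A *m bcirc B] equals it. *)
Lemma tr_tprod_bcirc (R : realType) (n p : nat) (A B : tensor R[i] n n p.+1) :
  tr_tprod A B = \tr (bcirc A *m bcirc B).
Proof.
rewrite tr_tprodE /bcirc mul_mxblock mxtrace_mxblock.
have -> : \sum_(k < p.+1) \tr (dft (tprod A B) k) =
    p.+1%:R * \tr (tprod A B 0).
  under eq_bigr do rewrite ffunE raddf_sum /=.
  rewrite exchange_big /= (bigD1 0)//= [X in _ + X]big1 => [|j j0].
    rewrite addr0 -(mul1r p.+1%:R) -(sum_dft_root R p 0) mulr_suml.
    by apply: eq_bigr => k _; rewrite mxtraceZ.
  under eq_bigr do rewrite mxtraceZ.
  by rewrite -mulr_suml sum_dft_root (negPf j0) !mul0r.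
have tE : tprod A B 0 = \sum_l (A (- l) *m B l).
  rewrite /tprod /bcirc /unfold mul_mxblock_mxrow ffunE mxcolK.
  by under eq_bigr do rewrite sub0r.
transitivity (\sum_(i < p.+1) \tr (tprod A B 0)).
  by rewrite sumr_const card_ord mulr_natl.
apply: eq_bigr => i _; rewrite tE (reindex_inj (addIr (- i))) /=.
by congr (\tr _); apply: eq_bigr => k _; rewrite opprB.
Qed.

(** [bcirc] carries the tensor adjoint to the matrix adjoint, so [bcirc A] is its own adjoint. *)
Lemma thermitian_normal (R : realType) (n p : nat) (A : tensor R[i] n n p.+1) :
  thermitian A -> bcirc A \is normalmx.
Proof.
move=> hA; have E : map_mx Num.conj (bcirc A)^T = bcirc A.
  by rewrite [RHS](congr1 (@bcirc _ _ _ _) hA) bcirc_tctr.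
by apply/normalmxP; rewrite E.
Qed.

Lemma char_poly_bcirc (R : realType) (n p : nat) (A : tensor R[i] n n p.+1) :
  char_poly (bcirc A) = \prod_(x <- teigs A) ('X - x%:P).
Proof.
rewrite /teigs; case: closed_field_poly_normal => r /= {1}->.
rewrite (monicP (char_poly_monic _)) scale1r.
by apply: perm_big; rewrite perm_sym perm_sort.
Qed.

Theorem theorem3p5 (R : realType) (n p : nat) (A B : tensor R n n p.+1)
    (hA : thermitian (tcomplex A)) (hB : thermitian (tcomplex B)) :
  \sum_(i < p.+1 * n) teig (tcomplex A) i * teig (tcomplex B) (rev_ord i)
    <= tr_tprod (tcomplex A) (tcomplex B)
    <= \sum_(i < p.+1 * n) teig (tcomplex A) i * teig (tcomplex B) i.
Proof.
have := normal_trace_bounds _ _ _ _ _ _ (thermitian_normal _ _ _ _ hA)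
  (thermitian_normal _ _ _ _ hB)
  (char_poly_bcirc _ _ _ _) (char_poly_bcirc _ _ _ _)
  (teigs_sorted hA) (teigs_sorted hB).
rewrite -tr_tprod_bcirc /teig /rev_ord /=.
(* The size of [bcirc] is a sum of [p.+1] copies of [n], here turned into the [p.+1 * n] of the
   index range. *)
by rewrite sum_nat_const card_ord.
Qed.
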